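(* For $r,s\in\mathbb N$ such that $s\leq r\neq0$, $1\leq\lambda_1<\cdots<\lambda_s\leq r$, and positive real numbers $a_1,\dots,a_r,b_1,\dots,b_s$ satisfying, for all $1\leq i\leq r$ and $1\leq j\leq s$, $b_j>a_i$ if $i\leq\lambda_j$ and $b_j>a_i-1$ if $i\geq\lambda_j+1$, let $(P_n(x))_{n\in\mathbb N}$ be the $r$-orthogonal polynomial sequence defined by $$P_n(x)=\frac{(-1)^n(a_1)_n\cdots(a_r)_n}{\left(b_1^{(n-1)}\right)_n\cdots\left(b_s^{(n-1)}\right)_n}\;{}_{s+1}F_r\left(\left.\begin{matrix}-n,b_1^{(n-1)},\dots,b_s^{(n-1)}\\ a_1,\dots,a_r\end{matrix}\,\right|\,x\right),\qquad b_j^{(n-1)}=b_j+\left\lceil\frac{n-\lambda_j}{r}\right\rceil.$$ Then, $(P_n(x))_{n\in\mathbb N}$ satisfies the recurrence relation $$P_{n+1}(x)=x\,P_n(x)-\sum_{k=0}^{r}\gamma^{[k]}_{n-k}\,P_{n-k}(x)$$ (with terms of negative index $n-k<0$ omitted), where the recurrence coefficients are given by $$\gamma^{[k]}_n=\sum_{r\geq\ell_0>\cdots>\ell_k\geq0}\ \prod_{j=0}^{k}\alpha_{(r+1)(n+j)+\ell_j}\qquad(n\in\mathbb N,\ 0\leq k\leq r),$$ with $(\alpha_{k})_{k\in\mathbb N}$ defined in the context, are all positive, and have asymptotic behaviour $$\gamma^{[k]}_n\sim C^{[k]}_{[n]_r}\,n^{(r-s)(k+1)}\qquad\text{as }n\to\infty,$$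 where, for any $1\leq j\leq r$, $$C^{[k]}_j=\left(\frac r{r+1}\right)^{s(k+1)}\sum_{r\geq\ell_0>\cdots>\ell_k\geq0}(r+1)^{-f_j(\ell_0,\dots,\ell_k)},$$ with $$f_j(\ell_0,\dots,\ell_k)=\Big|\left\{0\leq i\leq k\ :\ [j+\ell_i+i]_r\in\{\lambda_1,\dots,\lambda_s\}\right\}\Big|.$$
   Context: $\mathbb N=\{0,1,2,\dots\}$; $(z)_0=1$, $(z)_n=z(z+1)\cdots(z+n-1)$ for $n\ge1$; ${}_pF_q\left(\left.\begin{matrix}c_1,\dots,c_p\\ d_1,\dots,d_q\end{matrix}\,\right|\,x\right)=\sum_{n\ge0}\frac{(c_1)_n\cdots(c_p)_n}{(d_1)_n\cdots(d_q)_n}\frac{x^n}{n!}$. For integers $k$ and $n\geq1$, $[k]_n$ is the unique element of $\{1,\dots,n\}$ congruent to $k$ modulo $n$. The coefficients $\alpha$: set $\alpha_j=0$ for $0\leq j\leq r-1$, $a_{r+1}=1$, and for $k\in\mathbb N$, $a_i^{(k)}=a_i+\left\lceil\frac{k+1-i}{r+1}\right\rceil$ ($1\le i\le r+1$), $b_j^{(k)}=b_j+\left\lceil\frac{k+1-\lambda_j}{r}\right\rceil$ ($1\le j\le s$); then $$\alpha_{k+r}=\frac{\prod_{i=1,i\neq[k]_{r+1}}^{r+1}a_i^{(k)}}{\prod_{j=1}^{s}b_j^{(k)}}\ \text{ if }[k]_r\notin\{\lambda_1,\dots,\lambda_s\},\qquad \alpha_{k+r}=\frac{\left(b_\ell^{(k)}-a_{[k]_{r+1}}^{(k)}\right)\prod_{i=1,i\neq[k]_{r+1}}^{r+1}a_i^{(k)}}{\left(b_\ell^{(k)}-1\right)\prod_{j=1}^{s}b_j^{(k)}}\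 \text{ if }[k]_r=\lambda_\ell.$$ When $k=0$ and $\lambda_s=r$, the factor $(b_s-a_{r+1})/(b_s-1)=(b_s-1)/(b_s-1)$ is understood to be $1$. *)

(* Defs.v *)
From HB Require Import structures.
From mathcomp Require Import all_boot all_order all_algebra.
From mathcomp Require Import all_classical all_reals all_analysis.
Set Implicit Arguments.
Unset Strict Implicit.
Unset Printing Implicit Defensive.
Import Order.TTheory GRing.Theory Num.Theory.
Import numFieldNormedType.Exports.
Local Open Scope ring_scope.

(** The parameters [a_1, ..., a_r], [b_1, ..., b_s] and
    [lambda_1, ..., lambda_s] are given by functions [a b : nat -> R] and
    [lam : nat -> nat], numbered from 1 as in the mathematical notation; none of
    the definitions below looks at a value outside [1 <= i <= r], resp.
    [1 <= j <= s]. *)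

(** [[k]_n], the element of [{1, ..., n}] congruent to [k] modulo [n > 0];
    see [residue1_bounds], [residue1_mod] and [residue1_unique]. *)
Definition residue1 (k : int) (n : nat) : nat := `|((k - 1) %% n%:Z)%Z|.+1.

Lemma residue1_bounds (k : int) (n : nat) (n0 : (0 < n)%N) :
  (1 <= residue1 k n <= n)%N.
Proof.
rewrite /residue1 /= -ltz_nat gez0_abs ?modz_ge0 ?ltz_pmod //.
by rewrite eqz_nat -lt0n.
Qed.

Lemma residue1_mod (k : int) (n : nat) (n0 : (0 < n)%N) :
  (Posz (residue1 k n) = k %[mod n%:Z])%Z.
Proof.
rewrite /residue1 -addn1 PoszD gez0_abs ?modz_ge0 ?eqz_nat -?lt0n //.
by rewrite modzDml subrK.
Qed.

Lemma residue1_unique (k : int) (n m : nat) :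
  (1 <= m <= n)%N -> (Posz m = k %[mod n%:Z])%Z -> m = residue1 k n.
Proof.
case: m => // m /= mn mk; rewrite /residue1; congr S.
have -> : ((k - 1) %% n%:Z)%Z = ((Posz m.+1 - 1) %% n%:Z)%Z.
  by rewrite -modzDml -mk modzDml.
by rewrite intS addrAC subrr add0r modz_small.
Qed.

(** [ceil_div m n] is the ceiling of the rational number [m / n]. *)
Definition ceil_div (m : int) (n : nat) : int := Num.ceil (m%:Q / n%:Q).

Section Definitions.
Variable R : realType.
Implicit Types (a b : nat -> R) (lam : nat -> nat) (r s : nat).

Definition pochhammer (z : R) (n : nat) : R := \prod_(0 <= i < n) (z + i%:R).

(** Generalised hypergeometric series, with the lists of its upper and lower
    parameters as first arguments. *)
Definition pFq (cs ds : seq R) (x : R) : R :=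
  limn (series (fun n : nat =>
    (\prod_(c <- cs) pochhammer c n) / (\prod_(d <- ds) pochhammer d n)
    * (x ^+ n / n`!%:R) : R^o)).

(** [a_i^(k)], with the convention [a_{r+1} = 1]. *)
Definition ashift r a (k : int) (i : nat) : R :=
  (if i == r.+1 then 1 else a i) + (ceil_div (k + 1 - i%:Z) r.+1)%:~R.

Definition bshift r lam b (k : int) (j : nat) : R :=
  b j + (ceil_div (k + 1 - (lam j)%:Z) r)%:~R.

Definition lams s lam : seq nat := [seq lam j | j <- index_iota 1 s.+1].

(** [P_n(x)] *)
Definition hyp_poly r s lam a b (n : nat) (x : R) : R :=
  let bn := bshift r lam b (n%:Z - 1) in
  (-1) ^+ n * (\prod_(1 <= i < r.+1) pochhammer (a i) n)
    / (\prod_(1 <= j < s.+1) pochhammer (bn j) n)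
  * pFq (- n%:R :: [seq bn j | j <- index_iota 1 s.+1])
        [seq a i | i <- index_iota 1 r.+1] x.

(** [alpha_{k+r}]. When [[k]_r] is one of the [lambda]s, it is [lambda_l] for
    [l] one more than its 0-based position in the list [lams s lam]. For [k = 0]
    this forces [lambda_s = r], [l = s], and the additional factor is 1 by
    convention. *)
Definition alpha_from r s lam a b (k : nat) : R :=
  let ak := ashift r a k%:Z in
  let bk := bshift r lam b k%:Z in
  let i0 := residue1 k%:Z r.+1 in
  let c := residue1 k%:Z r in
  let base := (\prod_(1 <= i < r.+2 | i != i0) ak i)
              / (\prod_(1 <= j < s.+1) bk j) in
  if c \notin lams s lam then base
  else let l := (index c (lams s lam)).+1 in
       (if k == 0%N then 1 else (bk l - ak i0) / (bk l - 1)) * base.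

Definition alpha r s lam a b (m : nat) : R :=
  if (m < r)%N then 0 else alpha_from r s lam a b (m - r).

(** The index tuples [r >= l_0 > ... > l_k >= 0]. *)
Definition decreasing r k (l : {ffun 'I_k.+1 -> 'I_r.+1}) : bool :=
  [forall i : 'I_k.+1, forall j : 'I_k.+1, (i < j)%N ==> (l j < l i)%N].

Definition gamma r s lam a b (k n : nat) : R :=
  \sum_(l : {ffun 'I_k.+1 -> 'I_r.+1} | decreasing l)
    \prod_(j < k.+1) alpha r s lam a b (r.+1 * (n + j) + l j).

(** [f_j(l_0, ..., l_k)] *)
Definition lam_count r s lam (j k : nat) (l : {ffun 'I_k.+1 -> 'I_r.+1}) : nat :=
  #|[pred i : 'I_k.+1 | residue1 (j + l i + i)%N%:Z r \in lams s lam]|.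

(** [C^[k]_j] *)
Definition gamma_const r s lam (k j : nat) : R :=
  (r%:R / r.+1%:R) ^+ (s * k.+1)
  * \sum_(l : {ffun 'I_k.+1 -> 'I_r.+1} | decreasing l)
      r.+1%:R ^- lam_count s lam j l.

End Definitions.

(* Main.v *)
(** Let [Q_0 = 1] and [Q_{N+1}(x) = x Q_N(x) - alpha_N Q_{N-r}(x)]. This sequence
    is [(r+1)]-fold symmetric, [Q_{(r+1)n+j}(x) = x^j P_n^{[j]}(x^(r+1))], and the
    coefficients of all the components [P_n^{[j]}] are ratios of Pochhammer
    symbols, because the one-step shifts of the parameters [a_i^(k)] (at
    [i = [k]_{r+1}]) and [b_j^(k)] (at [lambda_j = [k]_r]) turn the recurrence for
    [Q_N] into a contiguous relation. The hypergeometric polynomial [P_n] is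
    [P_n^{[0]}]. Expanding [x P_n^{[0]}] through [P_n^{[1]}, ..., P_n^{[r]}],
    where passing from level [j] to level [j+1] either keeps [n] or lowers it by
    one at the cost of a factor [alpha_{(r+1)n+j}], gives the recurrence, the
    coefficients [gamma] being sums over the levels at which [n] is lowered.

    Positivity of [gamma] follows from that of [alpha], and the asymptotics from
    [a_i^(k) ~ n], [b_j^(k) ~ n (r+1)/r] for [k = (r+1) n + O(1)]. *)
Require Import Defs.
From mathcomp Require Import all_boot all_order all_algebra.
From mathcomp Require Import all_classical all_reals all_analysis.
From mathcomp Require Import ring lra zify.
Import Order.TTheory GRing.Theory Num.Theory.
Import numFieldNormedType.Exports.
Local Open Scope classical_set_scope.
Local Open Scope ring_scope.

(** * Integer arithmetic of ceilings and residues *)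

Lemma ceil_div_bounds (m : int) (n : nat) : (0 < n)%N ->
  (ceil_div m n - 1) * n%:Z < m <= ceil_div m n * n%:Z.
Proof.
move=> n0; have := ceil_itv (m%:Q / n%:Q); rewrite -/(ceil_div m n).
have n0Q : 0 < n%:Q by rewrite ltr0z ltz_nat.
by rewrite ltr_pdivlMr // ler_pdivrMr // -!intrM ltr_int ler_int.
Qed.

Lemma ceil_div_unique (m c : int) (n : nat) : (0 < n)%N ->
  (c - 1) * n%:Z < m <= c * n%:Z -> ceil_div m n = c.
Proof.
move=> n0; have n0Q : 0 < n%:Q by rewrite ltr0z ltz_nat.
rewrite -(ltr_int rat) -(ler_int rat) !(intrM _ _ n) => h.
by apply: ceil_def; rewrite ltr_pdivlMr // ler_pdivrMr.
Qed.

Lemma ceil_div_mul (m : int) (n : nat) (q : int) : (0 < n)%N ->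
  ceil_div (m + n%:Z * q) n = ceil_div m n + q.
Proof.
move=> n0; have := ceil_div_bounds m _ n0.
by have := ceil_div_bounds (m + n%:Z * q) _ n0; nia.
Qed.

Lemma ceil_div_ge0 (m : int) (n : nat) : (0 < n)%N -> - n%:Z < m ->
  0 <= ceil_div m n.
Proof. by move=> n0 mn; have := ceil_div_bounds m _ n0; nia. Qed.

Lemma residue1E (k : int) (n m : nat) : (0 < n)%N -> (1 <= m <= n)%N ->
  (m == residue1 k n) = (n%:Z %| k - m%:Z)%Z.
Proof.
move=> n0 mn; apply/eqP/idP => [->|h].
  by rewrite -eqz_mod_dvd eq_sym; apply/eqP/residue1_mod.
by apply: residue1_unique => //; apply/eqP; rewrite eq_sym eqz_mod_dvd.
Qed.

(** The ceiling of (k + 1 - m)/n jumps exactly when n divides k - m. Hence a one-step change of k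
    moves only the parameters attached to the residue of k. *)
Lemma ceil_div_pred (k : int) (n m : nat) : (0 < n)%N -> (1 <= m <= n)%N ->
  ceil_div (k - m%:Z) n = ceil_div (k + 1 - m%:Z) n - (m == residue1 k n)%:R.
Proof.
move=> n0 mn; rewrite residue1E //.
have -> : k + 1 - m%:Z = k - m%:Z + 1 by ring.
case: dvdzP => [[q ->]|ndiv] /=.
  rewrite (ceil_div_unique _ q) 1?(ceil_div_unique (_ + 1) (q + 1)) ?addrK //.
    by rewrite mulrDl mul1r; lia.
  by rewrite mulrBl mul1r; lia.
rewrite subr0; apply: ceil_div_unique => //.
have := ceil_div_bounds (k - m%:Z + 1) _ n0.
set c := ceil_div _ _ => /andP[h1 h2].
have [eq1|?] := eqVneq (k - m%:Z) ((c - 1) * n%:Z); last by lia.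
by case: ndiv; exists (c - 1).
Qed.

(** Here (k - m)/n is an integer, so the ceiling is known exactly; this allows the shifts modulo r
    and modulo r+1 to be compared. *)
Lemma residue1_ceil (k : int) (n m : nat) : (0 < n)%N -> (1 <= m <= n)%N ->
  m = residue1 k n -> n%:Z * (ceil_div (k + 1 - m%:Z) n - 1) = k - m%:Z.
Proof.
move=> n0 mn /eqP; rewrite residue1E // => /dvdzP[q kq].
have -> : k + 1 - m%:Z = k - m%:Z + 1 by ring.
rewrite kq (ceil_div_unique _ (q + 1)) // ?addrK 1?mulrC //.
by rewrite mulrDl mul1r; lia.
Qed.

Lemma residue1_mul (k q : int) (n : nat) : residue1 (k + n%:Z * q) n = residue1 k n.
Proof. by rewrite /residue1 addrAC addrC mulrC modzMDl. Qed.

Lemma residue1_0 (n : nat) : (0 < n)%N -> residue1 0 n = n.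
Proof.
by move=> n0; apply/esym/residue1_unique; rewrite ?n0 ?leqnn // modzz mod0z.
Qed.

(** * Identities for Pochhammer symbols *)

Section Pochhammer.
Variable R : realType.
Implicit Types (z : R) (n : nat).

Lemma poch0 z : pochhammer z 0 = 1.
Proof. by rewrite /pochhammer big_geq. Qed.

Lemma pochS z n : pochhammer z n.+1 = pochhammer z n * (z + n%:R).
Proof. by rewrite /pochhammer big_nat_recr. Qed.

Lemma pochSl z n : pochhammer z n.+1 = z * pochhammer (z + 1) n.
Proof.
rewrite /pochhammer big_nat_recl //= addr0; congr (_ * _).
by apply: eq_bigr => i _; rewrite -natr1; ring.
Qed.

Lemma pochD z m n : pochhammer z (m + n) = pochhammer z m * pochhammer (z + m%:R) n.
Proof.
elim: m z => [|m IH] z; first by rewrite poch0 mul1r addr0.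
by rewrite addSn !pochSl IH -natr1 mulrA [m%:R + 1]addrC addrA.
Qed.

Lemma poch_gt0 z n : 0 < z -> 0 < pochhammer z n.
Proof.
by move=> z0; elim: n => [|n IH]; rewrite ?poch0 // pochS mulr_gt0 // ltr_wpDr.
Qed.

Lemma poch1 n : pochhammer 1 n = n`!%:R :> R.
Proof.
by elim: n => [|n IH]; rewrite ?poch0 // pochS IH factS natrM -natr1; ring.
Qed.

Lemma pochN n m : (m <= n)%N ->
  pochhammer (- n%:R) m = (-1) ^+ m * n`!%:R / (n - m)`!%:R :> R.
Proof.
elim: m => [|m IH] mn.
  by rewrite poch0 expr0 subn0 mul1r divff // pnatr_eq0 -lt0n fact_gt0.
rewrite pochS.
have -> : - n%:R + m%:R = - (n - m.+1).+1%:R :> R.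
  by rewrite subnSK // natrB ?(ltnW mn) //; ring.
rewrite IH ?(ltnW mn) // -(subnSK mn) factS natrM exprS; field.
by rewrite nat1r !pnatr_eq0 -lt0n fact_gt0.
Qed.

End Pochhammer.

(** * Limits for sequences of linear growth and for finite products *)

Section Asymptotics.
Variable R : realType.

(** Squeezes the quotient between c - C/(n+1) and c + C/(n+1). *)
Lemma cvg_div_linear (u : nat -> R) (c C : R) :
  (forall n, `|u n - c * n.+1%:R| <= C) ->
  (fun n => u n / n.+1%:R) @ \oo --> c.
Proof.
move=> uC; apply: (@squeeze_cvgr _ _ _ _ (fun n => c - C * harmonic n)
    (fun n => c + C * harmonic n)).
- near=> n; have := uC n; rewrite ler_norml /harmonic => /andP[h1 h2].
  rewrite ler_pdivlMr // ler_pdivrMr // !mulrDl mulNr -!mulrA mulVf ?mulr1 //.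
  by apply/andP; split; lra.
- rewrite -[X in _ --> X](subr0 c) -[X in _ --> _ - X](mulr0 C).
  by apply: cvgB; [exact: cvg_cst|apply: cvgMl_tmp; exact: cvg_harmonic].
- rewrite -[X in _ --> X](addr0 c) -[X in _ --> _ + X](mulr0 C).
  by apply: cvgD; [exact: cvg_cst|apply: cvgMl_tmp; exact: cvg_harmonic].
Unshelve. all: by end_near. Qed.

Lemma cvg_eq (u v : nat -> R) (l : R) :
  (forall n, u n = v n) -> v @ \oo --> l -> u @ \oo --> l.
Proof. by move=> /funext ->. Qed.

Lemma cvg_prod_seq (I : Type) (t : seq I) (P : pred I) (u : I -> nat -> R)
    (c : I -> R) : (forall i, P i -> u i n @[n --> \oo] --> c i) ->
  (\prod_(i <- t | P i) u i n) @[n --> \oo] --> \prod_(i <- t | P i) c i.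
Proof. by apply: cvg_big; exact: mul_continuous. Qed.

End Asymptotics.

(** * Sums over decreasing index tuples and the abstract recurrence *)

Section DecreasingSums.
Variables (R : comPzRingType) (r : nat) (F : nat -> nat -> R).

(** The bound [m] and the possibly zero length [k] allow induction on the level; the tuples of
    [gamma] have bound [r.+1] and positive length. *)
Definition decr_below (m k : nat) (l : {ffun 'I_k -> 'I_r.+1}) : bool :=
  [forall i : 'I_k, forall j : 'I_k, (i < j)%N ==> (l j < l i)%N]
  && [forall i, (l i < m)%N].

Definition decr_sum (m k n : nat) : R :=
  \sum_(l : {ffun 'I_k -> 'I_r.+1} | decr_below m k l)
    \prod_(j < k) F (n + j) (l j).

Lemma decr_belowP m k (l : {ffun 'I_k -> 'I_r.+1}) :
  reflect ((forall i j : 'I_k, (i < j)%N -> (l j < l i)%N) /\ (forall i, (l i < m)%N))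
    (decr_below m k l).
Proof.
apply: (iffP andP) => [[/forallP h1 /forallP h2]|[h1 h2]]; split=> //.
- by move=> i j; have /forallP/(_ j)/implyP := h1 i.
- by apply/forallP => i; apply/forallP => j; apply/implyP/h1.
- exact/forallP.
Qed.

Lemma decr_sum0 m n : decr_sum m 0 n = 1.
Proof.
rewrite /decr_sum (big_pred1 [ffun=> ord0]).
  by rewrite big_ord0.
move=> l /=; have -> : l = [ffun=> ord0] by apply/ffunP => -[].
by rewrite eqxx; apply/decr_belowP; split => -[].
Qed.

(* Split according to whether the largest index [l_0] equals [m]. *)
Lemma decr_sumS m k n : (m <= r)%N -> decr_sum m.+1 k.+1 n =
  decr_sum m k.+1 n + F n m * decr_sum m k n.+1.
Proof.
move=> mr; rewrite /decr_sum (bigID (fun l : {ffun _ -> _} => val (l ord0) == m)) /=.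
rewrite addrC; congr (_ + _).
  (* The first entry of a decreasing tuple is its maximum, so excluding the value [m] there puts
     every entry below [m]. *)
  apply: eq_bigl => l; apply/andP/decr_belowP => [[/decr_belowP[h1 h2] l0]|[h1 h2]].
    split=> // i; have l0m : (l ord0 < m)%N.
      by rewrite ltn_neqAle l0 -ltnS h2.
    have [->//|i0] := eqVneq i ord0.
    by apply: leq_trans l0m; apply: ltnW; rewrite ltnS; apply: h1; rewrite lt0n.
  split; last by rewrite neq_ltn h2.
  by apply/decr_belowP; split=> // i; apply: ltnW; rewrite ltnS h2.
rewrite mulr_sumr.
(* Prepending [m] is a bijection onto the tuples with first entry [m]; [res] drops that entry
   again. *)
pose ext (l : {ffun 'I_k -> 'I_r.+1}) : {ffun 'I_k.+1 -> 'I_r.+1} :=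
  [ffun i => if unlift ord0 i is Some j then l j else inord m].
pose res (l : {ffun 'I_k.+1 -> 'I_r.+1}) : {ffun 'I_k -> 'I_r.+1} :=
  [ffun j => l (lift ord0 j)].
have ext0 l : ext l ord0 = inord m by rewrite ffunE unlift_none.
have extS l j : ext l (lift ord0 j) = l j by rewrite ffunE liftK.
rewrite (reindex_onto ext res) /=; last first.
  move=> l /andP[_ /eqP l0]; apply/ffunP => i; rewrite ffunE.
  case: unliftP => [j ->|->]; first by rewrite ffunE.
  by apply: val_inj; rewrite /= inordK // l0.
apply: eq_big => [l|l _].
  rewrite ext0 inordK // eqxx andbT.
  have -> : res (ext l) == l by apply/eqP/ffunP => j; rewrite ffunE extS.
  rewrite andbT; apply/decr_belowP/decr_belowP => -[h1 h2]; split.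
  - by move=> i j ij; rewrite -!extS; apply: h1; rewrite !lift0.
  - by move=> i; have := h1 ord0 (lift ord0 i); rewrite ext0 extS inordK //; apply.
  - move=> i j; case: (unliftP ord0 j) => [j' ->|-> //].
    case: (unliftP ord0 i) => [i' ->|->]; first by rewrite !extS; apply: h1.
    by rewrite ext0 extS inordK.
  - move=> i; case: (unliftP ord0 i) => [i' ->|->].
      by rewrite extS ltnS ltnW.
    by rewrite ext0 inordK.
(* Detaching the first factor lowers each remaining position by one, which [n.+1] compensates. *)
rewrite big_ord_recl /= addn0 ext0 inordK //; congr (_ * _).
by apply: eq_bigr => j _; rewrite extS /bump leq0n add1n addSnnS.
Qed.

Lemma decr_sum_small k n : decr_sum 0 k.+1 n = 0.
Proof.
by rewrite /decr_sum big1 // => l /decr_belowP[_ /(_ ord0)].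
Qed.

(** There are too few levels for a strictly decreasing tuple of this length. This truncates the
    recurrence at k = r. *)
Lemma decr_sum_gt m k n : (m <= r.+1)%N -> (m < k)%N -> decr_sum m k n = 0.
Proof.
elim: m k n => [|m IH] [|k] n // mr mk; first exact: decr_sum_small.
by rewrite decr_sumS // !IH ?mulr0 ?addr0 //; lia.
Qed.

(** [p n j] abstracts the value at [x] of the component P_n^{[j]}, and [F n j] abstracts
    alpha_{(r+1)n+j}. Index 0 gets its own hypotheses because a component of index -1 would
    otherwise occur. *)
Variables (x : R) (p : nat -> nat -> R).
Hypothesis F0 : forall j, (j < r)%N -> F 0 j = 0.
Hypothesis p0 : forall j, (j < r)%N -> p 0 j = p 0 j.+1.
Hypothesis pS : forall n j, (j < r)%N ->
  p n.+1 j = p n.+1 j.+1 + F n.+1 j * p n j.+1.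
Hypothesis p_top : forall n, x * p n r = p n.+1 0 + F n r * p n 0.

(** Climbing from level 0 to level [m], the index either stays or drops by one at the cost of a
    factor [F]. A tuple records the levels of the drops, the last drop first, and [k] counts
    them. *)
Lemma decr_sum_expand n m : (m <= r)%N ->
  p n 0 = \sum_(0 <= k < n.+1) decr_sum m k (n.+1 - k) * p (n - k) m.
Proof.
elim: m => [|m IH] mr.
  rewrite big_nat_recl //= decr_sum0 mul1r !subn0 big1 ?addr0 // => k _.
  by rewrite decr_sum_small mul0r.
rewrite IH ?(ltnW mr) //.
have pE k : p (n - k) m = p (n - k) m.+1 + F (n - k) m * p (n - k.+1) m.+1.
  rewrite subnS; case: (n - k)%N => [|q]; last exact: pS.
  by rewrite F0 // mul0r addr0 p0.
under eq_bigr do rewrite pE mulrDr.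
(* The k = n term of the second sum vanishes because [F 0 m = 0]; the others are shifted by one and
   combine with the first sum through [decr_sumS]. *)
rewrite big_split /= [X in _ + X]big_nat_recr //= subnn F0 // mul0r mulr0 addr0.
rewrite big_nat_recl //= [in RHS]big_nat_recl //= !decr_sum0 -addrA; congr (_ + _).
rewrite -big_split /=; apply: eq_big_nat => k /andP[_ kn].
rewrite !subSS decr_sumS ?(ltnW mr) // (subSn (ltnW kn)).
by ring.
Qed.

(** Multiplying the expansion at level [r] by [x] and applying [p_top] closes the cycle of levels;
    the two resulting sums merge by [decr_sumS]. *)
Lemma decr_sum_rec n : p n.+1 0 = x * p n 0
  - \sum_(0 <= k < r.+1 | (k <= n)%N)
      decr_sum r.+1 k.+1 (n - k) * p (n - k) 0.
Proof.
have -> : \sum_(0 <= k < r.+1 | (k <= n)%N)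
      decr_sum r.+1 k.+1 (n - k) * p (n - k) 0 =
    \sum_(0 <= k < n.+1) decr_sum r.+1 k.+1 (n - k) * p (n - k) 0.
  have [nr|rn] := leqP n.+1 r.+1.
    by rewrite [RHS](big_nat_widen _ _ _ _ _ nr); apply: eq_bigl => k.
  rewrite [RHS](big_cat_nat (leq0n _) (ltnW rn)) /=.
  rewrite [X in _ = _ + X]big_nat [X in _ = _ + X]big1 ?addr0 => [|k /andP[rk _]].
    by rewrite big_nat_cond [RHS]big_nat_cond; apply: eq_bigl => k; lia.
  by rewrite decr_sum_gt ?mul0r.
rewrite (decr_sum_expand n r) // mulr_sumr.
under eq_bigr do rewrite mulrCA p_top mulrDr.
rewrite big_split /= [X in _ = X + _ - _]big_nat_recl //= decr_sum0 mul1r subn0.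
have -> : \sum_(0 <= k < n) decr_sum r k.+1 (n.+1 - k.+1) * p (n - k.+1).+1 0 =
  \sum_(0 <= k < n.+1) decr_sum r k.+1 (n - k) * p (n - k) 0.
  rewrite [RHS]big_nat_recr //= subnn.
  (* Every product contains a factor [F 0 l] with [l] below [r]. *)
  have -> : decr_sum r n.+1 0 = 0.
    rewrite /decr_sum big1 // => l /decr_belowP[_ lr].
    by rewrite big_ord_recl addn0 F0 ?mul0r.
  rewrite mul0r addr0; apply: eq_big_nat => k /andP[_ kn].
  by rewrite subSS subnSK.
rewrite -[LHS]addr0 -!addrA; congr (_ + _); apply/esym/eqP.
rewrite addrA subr_eq0; apply/eqP; rewrite -big_split /=.
apply: eq_big_nat => k /andP[_ kn]; rewrite decr_sumS // (subSn (kn : k <= n)%N).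
by ring.
Qed.

End DecreasingSums.

(** * The shifted parameters: periodicity, one-step changes and positivity *)

Section Recurrence.
Variables (R : realType) (r s : nat) (lam : nat -> nat) (a b : nat -> R).
Hypothesis s_le_r : (s <= r)%N.
Hypothesis r_gt0 : (0 < r)%N.
Hypothesis lam_bounds : forall j : nat, (1 <= j <= s)%N -> (1 <= lam j <= r)%N.
Hypothesis lam_incr : forall i j : nat, (1 <= i)%N -> (i < j)%N -> (j <= s)%N ->
  (lam i < lam j)%N.
Hypothesis a_pos : forall i : nat, (1 <= i <= r)%N -> 0 < a i.
Hypothesis b_pos : forall j : nat, (1 <= j <= s)%N -> 0 < b j.

Let Ash := ashift r a.
Let Bsh := bshift r lam b.

Lemma ashift_mul (k q : int) (i : nat) : Ash (k + r.+1%:Z * q) i = Ash k i + q%:~R.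
Proof.
rewrite /Ash /ashift -[RHS]addrA -intrD; congr (_ + _%:~R).
by rewrite -ceil_div_mul //; congr ceil_div; ring.
Qed.

Lemma bshift_mul (k q : int) (j : nat) : Bsh (k + r%:Z * q) j = Bsh k j + q%:~R.
Proof.
rewrite /Bsh /bshift -[RHS]addrA -intrD; congr (_ + _%:~R).
by rewrite -ceil_div_mul //; congr ceil_div; ring.
Qed.

Lemma ashift_pred (k : int) (i : nat) : (1 <= i <= r.+1)%N ->
  Ash (k - 1) i = Ash k i - (i == residue1 k r.+1)%:R.
Proof.
move=> ir; rewrite /Ash /ashift subrK ceil_div_pred //.
by rewrite intrB addrA mulrz_nat.
Qed.

Lemma bshift_pred (k : int) (j : nat) : (1 <= j <= s)%N ->
  Bsh (k - 1) j = Bsh k j - (lam j == residue1 k r)%:R.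
Proof.
move=> js; rewrite /Bsh /bshift subrK ceil_div_pred ?lam_bounds //.
by rewrite intrB addrA mulrz_nat.
Qed.

Lemma ashift_gt0 (k i : nat) : (1 <= i <= r.+1)%N -> 0 < Ash k%:Z i.
Proof.
move=> ir; rewrite /Ash /ashift ltr_wpDr //.
  by rewrite ler0z ceil_div_ge0 //; lia.
by case: eqP => // ?; apply: a_pos; lia.
Qed.

Lemma bshift_ge (k j : nat) : (1 <= j <= s)%N -> b j <= Bsh k%:Z j.
Proof.
move=> js; rewrite /Bsh /bshift lerDl ler0z ceil_div_ge0 //.
by have := lam_bounds _ js; lia.
Qed.

Lemma bshift_gt0 (k j : nat) : (1 <= j <= s)%N -> 0 < Bsh k%:Z j.
Proof. by move=> js; apply: lt_le_trans (bshift_ge _ _ js); apply: b_pos. Qed.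

Lemma lam_inj i j : (1 <= i <= s)%N -> (1 <= j <= s)%N -> lam i = lam j -> i = j.
Proof.
move=> ? ? e; have [h|h|//] := ltngtP i j.
  by have := lam_incr i j; lia.
by have := lam_incr j i; lia.
Qed.

Lemma lams_index c : c \in lams s lam ->
  (1 <= (index c (lams s lam)).+1 <= s)%N /\ lam (index c (lams s lam)).+1 = c.
Proof.
move=> h; move: (h); rewrite -index_mem /lams size_map size_iota => idx.
split; first by lia.
rewrite -[RHS](nth_index 0%N h) [in RHS]/lams (nth_map 0%N) ?size_iota //.
by rewrite /index_iota nth_iota // add1n.
Qed.

Lemma lams_notin c j : c \notin lams s lam -> (1 <= j <= s)%N -> lam j != c.
Proof.
move=> h js; apply: contraNneq h => <-; apply: map_f.
by rewrite mem_index_iota; lia.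
Qed.

(* The coefficient of [x^M] in the [(M + (r+1) d)]-th polynomial of the
   [(r+1)]-fold symmetric sequence [Q_{N+1} = x Q_N - alpha_N Q_{N-r}]. *)
Definition coef (M : int) (d : nat) : R :=
  (-1) ^+ d / d`!%:R * (\prod_(1 <= i < r.+2) pochhammer (Ash M i) d)
  / \prod_(1 <= j < s.+1) pochhammer (Bsh (M + d%:Z - 1) j) d.

(** * Initial values and the contiguous relation of the coefficients *)

Lemma coef0 M : coef M 0 = 1.
Proof.
rewrite /coef expr0 fact0 !big1 ?divr1 ?mulr1 // => i _; exact: poch0.
Qed.

(** The convention a_{r+1} = 1 gives a_{r+1}^{(-1)} = 0, which kills the numerator: no negative
    powers of x arise. *)
Lemma coefN1 d : coef (-1) d.+1 = 0.
Proof.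
rewrite /coef [in X in _ * X / _]big_nat_recr //=.
suff -> : Ash (-1) r.+1 = 0 by rewrite pochSl !(mul0r, mulr0).
rewrite /Ash /ashift eqxx (ceil_div_unique _ (-1)) ?subrr //.
by lia.
Qed.

(** This is the coefficient of x^M in Q_{N+1} = x Q_N - alpha_N Q_{N-r} with N = M + (r+1)d + r.
    Lowering M changes one a-parameter and at most one b-parameter, so after cancellation only a
    short rational identity remains. *)
Lemma coefS (M d : nat) : coef M%:Z d.+1 = coef (M%:Z - 1) d.+1
  - alpha_from r s lam a b (M + r.+1 * d) * coef M%:Z d.
Proof.
set k := (M + r.+1 * d)%N.
set i0 := residue1 M%:Z r.+1; set c := residue1 (M + d)%N%:Z r.
have i0E : residue1 k%:Z r.+1 = i0.
  by rewrite /k PoszD PoszM residue1_mul.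
(* [k] and M + d differ by r d. *)
have cE : residue1 k%:Z r = c.
  by rewrite /c -[RHS](residue1_mul _ d%:Z); congr (residue1 _ r); rewrite /k; lia.
have i0r : (1 <= i0 <= r.+1)%N by exact: residue1_bounds.
set A := \prod_(1 <= i < r.+2 | i != i0) pochhammer (Ash M%:Z i) d.
set A1 := \prod_(1 <= i < r.+2 | i != i0) (Ash M%:Z i + d%:R).
have AshS : \prod_(1 <= i < r.+2) pochhammer (Ash M%:Z i) d.+1 =
    pochhammer (Ash M%:Z i0) d.+1 * (A * A1).
  rewrite (bigD1_seq i0) ?iota_uniq ?mem_index_iota //= -big_split /=.
  by congr (_ * _); apply: eq_bigr => i _; rewrite pochS.
have AshE : \prod_(1 <= i < r.+2) pochhammer (Ash M%:Z i) d =
    pochhammer (Ash M%:Z i0) d * A.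
  by rewrite (bigD1_seq i0) ?iota_uniq ?mem_index_iota.
have AshP : \prod_(1 <= i < r.+2) pochhammer (Ash (M%:Z - 1) i) d.+1 =
    pochhammer (Ash M%:Z i0 - 1) d.+1 * (A * A1).
  rewrite (bigD1_seq i0) ?iota_uniq ?mem_index_iota //= ashift_pred // eqxx.
  congr (_ * _); rewrite -big_split /= big_seq_cond [RHS]big_seq_cond.
  apply: eq_bigr => i; rewrite mem_index_iota => /andP[ir ni].
  by rewrite ashift_pred // (negbTE ni) subr0 pochS.
have ashk : \prod_(1 <= i < r.+2 | i != i0) Ash k%:Z i = A1.
  apply: eq_bigr => i _.
  by rewrite /k PoszD PoszM ashift_mul.
have bk j : Bsh k%:Z j = Bsh (M + d)%N%:Z j + d%:R.
  by rewrite -[d%:R]/(d%:Z%:~R) -bshift_mul; congr (Bsh _ j); rewrite /k; lia.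
have AE : pochhammer (Ash M%:Z i0) d.+1
    - pochhammer (Ash M%:Z i0 - 1) d.+1 = d.+1%:R * pochhammer (Ash M%:Z i0) d.
  by rewrite pochS pochSl subrK -natr1; ring.
rewrite /coef AshS AshP AshE /alpha_from i0E cE.
(* The b-parameters are taken at M + d on the left and at M + d - 1 in both terms on the right. *)
have -> : M%:Z + d.+1%:Z - 1 = (M + d)%N%:Z by lia.
have -> : M%:Z - 1 + d.+1%:Z - 1 = (M + d)%N%:Z - 1 by lia.
have -> : M%:Z + d%:Z - 1 = (M + d)%N%:Z - 1 by lia.
rewrite -/Ash -/Bsh ashk (eq_bigr _ (fun j _ => bk j)).
set BB := Bsh (M + d)%N%:Z.
have factE : d.+1`!%:R = d.+1%:R * d`!%:R :> R by rewrite factS natrM.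
have d1_neq0 : d.+1%:R != 0 :> R by rewrite pnatr_eq0.
have fact_neq0 : d`!%:R != 0 :> R by rewrite pnatr_eq0 -lt0n fact_gt0.
have BB0 j : (1 <= j <= s)%N -> 0 < BB j by exact: bshift_gt0.
case: ifPn => [cn|]; last first.
  rewrite negbK => /lams_index[]; set l := (index _ _).+1 => ls lc.
  set B := \prod_(1 <= j < s.+1 | j != l) pochhammer (BB j) d.
  set B1 := \prod_(1 <= j < s.+1 | j != l) (BB j + d%:R).
  have B_neq0 : B != 0.
    rewrite gt_eqF // /B big_seq_cond prodr_gt0 // => j; rewrite mem_index_iota.
    by move=> /andP[js _]; rewrite poch_gt0 // BB0.
  have B1_neq0 : B1 != 0.
    rewrite gt_eqF // /B1 big_seq_cond prodr_gt0 // => j; rewrite mem_index_iota.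
    by move=> /andP[js _]; rewrite ltr_wpDr // BB0.
  have lm : l \in index_iota 1 s.+1 by rewrite mem_index_iota.
  have BPE e : \prod_(1 <= j < s.+1) pochhammer (Bsh ((M + d)%N%:Z - 1) j) e =
      pochhammer (BB l - 1) e * \prod_(1 <= j < s.+1 | j != l) pochhammer (BB j) e.
    rewrite (bigD1_seq l) ?iota_uniq //= bshift_pred // lc eqxx; congr (_ * _).
    rewrite big_seq_cond [RHS]big_seq_cond.
    apply: eq_bigr => j; rewrite mem_index_iota => /andP[js nj].
    rewrite bshift_pred // -/c -lc; case: eqP => [/lam_inj e1|]; last by rewrite subr0.
    by rewrite e1 ?eqxx in nj.
  rewrite !BPE.
  rewrite (bigD1_seq l) ?iota_uniq //=.
  rewrite [\prod_(1 <= j < s.+1) (BB j + _)](bigD1_seq l) ?iota_uniq //=.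
  have -> : \prod_(1 <= j < s.+1 | j != l) pochhammer (BB j) d.+1 = B * B1.
    by rewrite -big_split /=; apply: eq_bigr => j _; rewrite pochS.
  rewrite -/B -/B1 factE exprS.
  have Bl0 := BB0 l ls; have pB0 := poch_gt0 _ _ d Bl0.
  have pA1 : pochhammer (Ash M%:Z i0 - 1) d.+1 =
    (Ash M%:Z i0 - 1) * pochhammer (Ash M%:Z i0) d by rewrite pochSl subrK.
  have pB1 : pochhammer (BB l - 1) d.+1 = (BB l - 1) * pochhammer (BB l) d.
    by rewrite pochSl subrK.
  rewrite pA1 pB1 !pochS.
  have Bld0 : BB l + d%:R != 0 by rewrite gt_eqF // ltr_wpDr.
  (* For k = 0 the number b_l - 1 may vanish. There a_{r+1}^{(0)} = 1 makes the coefficient at M - 1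
     zero, and the conventional factor 1 in alpha gives the identity. *)
  have [k0|k_gt0] := posnP k.
    have [M0 d0] : M = 0%N /\ d = 0%N by rewrite /k in k0; lia.
    have -> : Ash M%:Z i0 = 1.
      rewrite /i0 M0 residue1_0 // /Ash /ashift eqxx (ceil_div_unique _ 0) ?addr0 //.
      by lia.
    rewrite subrr !(mul0r, mulr0) d0 fact0 !poch0 in Bld0 *; field.
    by rewrite B_neq0 B1_neq0 gt_eqF.
  have Bl1 : 0 < BB l - 1.
    have Mk : (0 < M + d)%N by rewrite /k in k_gt0; nia.
    have := bshift_pred (M + d)%N%:Z l ls; rewrite lc eqxx => <-.
    have -> : (M + d)%N%:Z - 1 = (M + d).-1%:Z by lia.
    exact: bshift_gt0.
  have pB2 : pochhammer (BB l - 1) d =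
      (BB l - 1) * pochhammer (BB l) d / (BB l - 1 + d%:R).
    by rewrite -pB1 pochS mulfK // gt_eqF // ltr_wpDr.
  rewrite pB2 bk -/BB.
  have -> : Ash k%:Z i0 = Ash M%:Z i0 + d%:R by rewrite /k PoszD PoszM ashift_mul.
  rewrite -natr1 in d1_neq0 *; field.
  rewrite B_neq0 B1_neq0 fact_neq0 d1_neq0 Bld0 (gt_eqF Bl1) (gt_eqF pB0) /=.
  by rewrite ?gt_eqF // ltr_wpDr.
set B := \prod_(1 <= j < s.+1) pochhammer (BB j) d.
set B1 := \prod_(1 <= j < s.+1) (BB j + d%:R).
have B_neq0 : B != 0.
  rewrite gt_eqF // /B big_seq prodr_gt0 // => j; rewrite mem_index_iota => js.
  by rewrite poch_gt0 // BB0.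
have B1_neq0 : B1 != 0.
  rewrite gt_eqF // /B1 big_seq prodr_gt0 // => j; rewrite mem_index_iota => js.
  by rewrite ltr_wpDr // BB0.
have BPE e : \prod_(1 <= j < s.+1) pochhammer (Bsh ((M + d)%N%:Z - 1) j) e =
    \prod_(1 <= j < s.+1) pochhammer (BB j) e.
  rewrite big_seq [RHS]big_seq; apply: eq_bigr => j; rewrite mem_index_iota => js.
  by rewrite bshift_pred // (negbTE (lams_notin _ _ cn js)) subr0.
rewrite !BPE.
have -> : \prod_(1 <= j < s.+1) pochhammer (BB j) d.+1 = B * B1.
  by rewrite -big_split /=; apply: eq_bigr => j _; rewrite pochS.
rewrite -/B factE exprS; move/eqP: AE; rewrite subr_eq => /eqP ->.
by field; rewrite B_neq0 B1_neq0 fact_neq0 nat1r.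
Qed.


(* [P_n^{[j]}], where [Q_{(r+1)n+j}(x) = x^j P_n^{[j]}(x^(r+1))]. *)
Definition comp_poly (n j : nat) (x : R) : R :=
  \sum_(0 <= m < n.+1) coef (r.+1 * m + j)%N%:Z (n - m) * x ^+ m.

(** * Relations between consecutive components *)

Local Notation alph := (alpha r s lam a b).

Lemma alpha_lt m : (m < r)%N -> alph m = 0.
Proof. by rewrite /alpha => ->. Qed.

Lemma alphaD k : alph (k + r) = alpha_from r s lam a b k.
Proof. by rewrite /alpha ltnNge leq_addl addnK. Qed.

Lemma comp_poly0 j x : comp_poly 0 j x = 1.
Proof. by rewrite /comp_poly big_nat1 subnn coef0 mulr1. Qed.

(** Coefficientwise this is [coefS] at M = (r+1)m + j + 1; the top coefficients are all 1. *)
Lemma comp_polyS n j x : (j < r)%N -> comp_poly n.+1 j x =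
  comp_poly n.+1 j.+1 x + alph (r.+1 * n.+1 + j) * comp_poly n j.+1 x.
Proof.
move=> jr; rewrite /comp_poly [LHS]big_nat_recr // [in RHS]big_nat_recr //=.
rewrite subnn !coef0 addrAC; congr (_ + _).
rewrite mulr_sumr -big_split /=; apply: eq_big_nat => m /andP[_ mn].
rewrite subSn // [coef (r.+1 * m + j.+1)%N%:Z _]coefS -alphaD.
have -> : (r.+1 * m + j.+1 + r.+1 * (n - m) + r = r.+1 * n.+1 + j)%N by nia.
have -> : (r.+1 * m + j.+1)%N%:Z - 1 = (r.+1 * m + j)%N by lia.
by ring.
Qed.

(** Going from level r back to level 0 raises the exponent: [coefS] is applied at M = (r+1)m, and
    [coefN1] removes the term m = 0. *)
Lemma comp_poly_top n x : x * comp_poly n r x =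
  comp_poly n.+1 0 x + alph (r.+1 * n + r) * comp_poly n 0 x.
Proof.
rewrite /comp_poly [in RHS]big_nat_recr //= subnn coef0 mul1r addrAC.
rewrite [in RHS]mulr_sumr -big_split /=.
rewrite [X in _ = X + _](eq_big_nat _ _
  (F2 := fun m => coef ((r.+1 * m)%N%:Z - 1) (n - m).+1 * x ^+ m)); last first.
  move=> m /andP[_ mn]; rewrite subSn // addn0 [coef _ (n - m).+1]coefS -alphaD.
  have -> : (r.+1 * m + r.+1 * (n - m) + r = r.+1 * n + r)%N by nia.
  by ring.
rewrite [X in _ = X + _]big_nat_recl //= muln0 sub0r coefN1 mul0r add0r.
rewrite mulr_sumr big_nat_recr //= subnn coef0 mul1r exprS; congr (_ + _).
apply: eq_big_nat => m /andP[_ mn]; rewrite subnSK // exprS.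
have -> : (r.+1 * m.+1)%N%:Z - 1 = (r.+1 * m + r)%N by lia.
by ring.
Qed.

(** * The hypergeometric polynomial as the component at level 0 *)

Lemma pFq_finite (cs ds : seq R) (n : nat) (x : R) : - n%:R \in cs ->
  pFq cs ds x = \sum_(0 <= m < n.+1)
    (\prod_(c <- cs) pochhammer c m) / (\prod_(d <- ds) pochhammer d m)
    * (x ^+ m / m`!%:R).
Proof.
move=> ncs; apply: lim_near_cst => //.
exists n.+1 => // N /= nN; rewrite /series /= (big_cat_nat (leq0n _) nN) //=.
rewrite [X in _ + X]big_nat [X in _ + X]big1 ?addr0 // => m /andP[nm _].
(* For m > n the symbol (-n)_m contains the factor -n + n, so the partial sums are eventually
   constant. *)
suff -> : \prod_(c <- cs) pochhammer c m = 0 by rewrite !mul0r.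
apply/eqP; rewrite prodf_seq_eq0; apply/hasP; exists (- n%:R) => //=.
by rewrite -(subnKC nm) addSn -addnS pochD pochSl addNr !(mul0r, mulr0).
Qed.

(** Each symbol of length n is split at m. The halves of length m cancel against the series, and
    a_{r+1} = 1 contributes (1+m)_{n-m} = n!/m!. *)
Lemma hyp_polyE n x : hyp_poly r s lam a b n x = comp_poly n 0 x.
Proof.
rewrite /hyp_poly (pFq_finite _ _ n); last by rewrite mem_head.
rewrite mulr_sumr; apply: eq_big_nat => m /andP[_ mn].
rewrite big_cons !big_map pochN //.
rewrite /coef addn0 [in RHS]big_nat_recr //=.
have bE j : Bsh ((r.+1 * m)%N%:Z + (n - m)%N%:Z - 1) j = Bsh (n%:Z - 1) j + m%:R.
  by rewrite -[m%:R]/(m%:Z%:~R) -bshift_mul; congr (Bsh _ j); nia.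
rewrite [\prod_(1 <= j < s.+1) pochhammer _ (n - m)](eq_bigr _
  (fun j _ => congr1 (fun z => pochhammer z (n - m)) (bE j))).
have aE i : Ash (r.+1 * m)%N%:Z i = Ash 0 i + m%:R.
  by rewrite -[m%:R]/(m%:Z%:~R) -ashift_mul; congr (Ash _ i); lia.
rewrite [Ash _ r.+1]aE [\prod_(1 <= i < r.+1) pochhammer _ (n - m)](eq_bigr _
  (fun i _ => congr1 (fun z => pochhammer z (n - m)) (aE i))).
have -> : Ash 0 r.+1 = 1.
  by rewrite /Ash /ashift eqxx (ceil_div_unique _ 0) ?addr0 //; lia.
have pochE z : pochhammer z n = pochhammer z m * pochhammer (z + m%:R) (n - m).
  by rewrite -pochD subnKC.
have <- : \prod_(1 <= i < r.+1) pochhammer (a i) m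
    * \prod_(1 <= i < r.+1) pochhammer (Ash 0 i + m%:R) (n - m)
    = \prod_(1 <= i < r.+1) pochhammer (a i) n.
  rewrite -big_split /=; apply: eq_big_nat => i ir.
  rewrite pochE; congr (_ * pochhammer (_ + _) _).
  rewrite /Ash /ashift ifN ?(ceil_div_unique _ 0) ?addr0 //; first by lia.
  by lia.
have <- : \prod_(1 <= j < s.+1) pochhammer (Bsh (n%:Z - 1) j) m
    * \prod_(1 <= j < s.+1) pochhammer (Bsh (n%:Z - 1) j + m%:R) (n - m)
    = \prod_(1 <= j < s.+1) pochhammer (Bsh (n%:Z - 1) j) n.
  rewrite -big_split /=; apply: eq_big_nat => i ir.
  by rewrite -pochE.
have m1E : pochhammer (1 + m%:R) (n - m) = n`!%:R / m`!%:R :> R.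
  rewrite -!poch1 pochE mulrAC divff ?mul1r //.
  by rewrite gt_eqF // poch_gt0.
rewrite m1E.
have fm0 : m`!%:R != 0 :> R by rewrite pnatr_eq0 -lt0n fact_gt0.
have fnm0 : (n - m)`!%:R != 0 :> R by rewrite pnatr_eq0 -lt0n fact_gt0.
have a0 : \prod_(1 <= i < r.+1) pochhammer (a i) m != 0.
  rewrite gt_eqF // big_seq prodr_gt0 // => i; rewrite mem_index_iota => ir.
  by rewrite poch_gt0 // a_pos.
(* For n = 0 the numbers b_j^{(-1)} need not be positive, but then m = 0 and the symbols are 1. *)
have B0 : \prod_(1 <= j < s.+1) pochhammer (Bsh (n%:Z - 1) j) m != 0.
  case: n mn {bE m1E fnm0 pochE} => [|n] mn.
    have -> : m = 0%N by lia.
    by rewrite big1 ?oner_neq0 // => j _; rewrite poch0.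
  rewrite gt_eqF // big_seq prodr_gt0 // => i; rewrite mem_index_iota => ir.
  have -> : n.+1%:Z - 1 = n by lia.
  by rewrite poch_gt0 // bshift_gt0.
have sgn : (-1) ^+ n = (-1) ^+ m * (-1) ^+ (n - m) :> R by rewrite -exprD subnKC.
have sgn2 : (-1) ^+ m * (-1) ^+ m = 1 :> R by rewrite -expr2 sqrr_sign.
rewrite -/Bsh sgn invfM.
set X1 := \prod_(1 <= i < r.+1) pochhammer (a i) m in a0 *.
set Y1 := \prod_(1 <= j < s.+1) pochhammer (Bsh (n%:Z - 1) j) m in B0 *.
set Y2i := (\prod_(1 <= j < s.+1) pochhammer (Bsh (n%:Z - 1) j + m%:R) (n - m))^-1.
transitivity ((-1) ^+ m * (-1) ^+ m * (-1) ^+ (n - m) / (n - m)`!%:R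
  * (\prod_(1 <= i < r.+1) pochhammer (Ash 0 i + m%:R) (n - m) * (n`!%:R / m`!%:R))
  * Y2i * x ^+ m).
  by field; rewrite fm0 fnm0 a0 B0.
by rewrite sgn2 mul1r.
Qed.

(** * Positivity of alpha and gamma *)

Hypothesis a_lt_b : forall i j : nat, (1 <= i <= r)%N -> (1 <= j <= s)%N ->
  ((i <= lam j)%N -> a i < b j) /\ ((lam j + 1 <= i)%N -> a i - 1 < b j).

Lemma bshift_gt1 (k l : nat) : (0 < k)%N -> (1 <= l <= s)%N ->
  lam l = residue1 k%:Z r -> 1 < Bsh k%:Z l.
Proof.
move=> k0 ls lc; rewrite -subr_gt0.
have := bshift_pred k%:Z l ls; rewrite lc eqxx => <-.
have -> : k%:Z - 1 = k.-1%:Z by lia.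
exact: bshift_gt0.
Qed.

(** Both ceilings are exact: k = i + (r+1)(cA - 1) = lambda_l + r(cB - 1). So cA <= cB if i <=
    lambda_l and cA + 1 <= cB otherwise, matching the two cases of [a_lt_b]. *)
Lemma ashift_lt_bshift (k l : nat) : (0 < k)%N -> (1 <= l <= s)%N ->
  lam l = residue1 k%:Z r -> Ash k%:Z (residue1 k%:Z r.+1) < Bsh k%:Z l.
Proof.
move=> k0 ls lc; have lr := lam_bounds _ ls.
have ir := residue1_bounds k%:Z (ltn0Sn r).
have := residue1_ceil k%:Z r.+1 _ (ltn0Sn r) ir erefl.
have := residue1_ceil k%:Z r _ r_gt0 lr lc.
move: ir; rewrite /Bsh /bshift /Ash /ashift.
set i := residue1 k%:Z r.+1; move: (ceil_div _ r) (ceil_div _ r.+1) => cB cA ir eB eA.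
have [il|il] := leqP i (lam l).
  have cAB : cA <= cB by nia.
  have [+ _] := a_lt_b i l ltac:(lia) ls; move=> /(_ il) ab.
  by rewrite ifN ?ltr_leD ?ler_int //; lia.
have cA1 : 1 <= cA by nia.
have eAB : r%:Z * (cB - cA) = cA - 1 + (i%:Z - (lam l)%:Z) by lia.
have cAB : cA + 1 <= cB by nia.
apply: (@lt_le_trans _ _ (b l + (cA + 1)%:~R)); last by rewrite lerD2l ler_int.
rewrite intrD [cA%:~R + _]addrC addrA ltrD2r.
(* For i = r+1 the parameter is 1 and the claim becomes 0 < b_l. *)
case: eqP => [_|i_neq]; first by rewrite -{1}[1]add0r ltrD2r b_pos.
have [_] := a_lt_b i l ltac:(lia) ls; rewrite addn1 => /(_ il).
by rewrite ltrBlDr.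
Qed.

Lemma alpha_from_gt0 k : 0 < alpha_from r s lam a b k.
Proof.
rewrite /alpha_from -/Ash -/Bsh.
have base_gt0 : 0 < \prod_(1 <= i < r.+2 | i != residue1 k%:Z r.+1) Ash k%:Z i
    / \prod_(1 <= j < s.+1) Bsh k%:Z j.
  rewrite divr_gt0 // big_seq_cond prodr_gt0 // => i; rewrite mem_index_iota.
    by move=> /andP[ir _]; exact: ashift_gt0.
  by rewrite andbT => ?; exact: bshift_gt0.
case: ifPn => // /negPn/lams_index[]; set l := (index _ _).+1 => ls lc.
rewrite mulr_gt0 //; case: posnP => // k0.
by rewrite divr_gt0 // subr_gt0 ?ashift_lt_bshift ?bshift_gt1.
Qed.

Lemma alpha_ge0 m : 0 <= alph m.
Proof. by rewrite /alpha; case: ifP => // _; apply/ltW/alpha_from_gt0. Qed.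

Lemma alpha_gt0 m : (r <= m)%N -> 0 < alph m.
Proof. by move=> rm; rewrite -(subnK rm) alphaD alpha_from_gt0. Qed.

Lemma gamma_gt0 k n : (k <= r)%N -> 0 < gamma r s lam a b k n.
Proof.
(* Some terms may vanish, since alpha_m = 0 for m < r. The tuple (r, r-1, ..., r-k) uses only
   indices at least r. *)
move=> kr; pose l : {ffun 'I_k.+1 -> 'I_r.+1} := [ffun j : 'I_k.+1 => inord (r - j)].
have lE j : l j = (r - j)%N :> nat by rewrite ffunE inordK //; lia.
rewrite /gamma (bigD1 l) /=; last first.
  apply/forallP => i; apply/forallP => j; apply/implyP => ij; rewrite !lE.
  by have := ltn_ord j; lia.
rewrite ltr_pwDl //.
  by rewrite prodr_gt0 // => j _; rewrite alpha_gt0 // lE; nia.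
by rewrite sumr_ge0 // => l' _; rewrite prodr_ge0 // => j _; exact: alpha_ge0.
Qed.

(** * Asymptotics of the parameters, of alpha and of gamma *)

Lemma ashift_cvg (i j i' : nat) :
  (fun n => Ash (r.+1 * (n + j) + i)%N%:Z i' / n.+1%:R) @ \oo --> (1 : R).
Proof.
apply: (@cvg_div_linear _ _ _ `|Ash i%:Z i' + j%:R - 1|) => n.
rewrite addnC PoszD PoszM ashift_mul -[(n + j)%N%:Z%:~R]/((n + j)%:R) natrD -natr1.
by rewrite le_eqVlt; apply/orP; left; apply/eqP; congr `|_|; ring.
Qed.

Lemma bshift_cvg (i j j' : nat) :
  (fun n => Bsh (r.+1 * (n + j) + i)%N%:Z j' / n.+1%:R) @ \oo --> (r.+1%:R / r%:R : R).
Proof.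
(* [D] is what remains of the ceiling's numerator after removing (r+1)(n+1); rounding up adds less
   than r. *)
pose D : int := r.+1%:Z * (j%:Z - 1) + i%:Z + 1 - (lam j')%:Z.
apply: (@cvg_div_linear _ _ _ (`|b j'| + (`|D|%:~R + r%:R))) => n.
rewrite /Bsh /bshift.
have := ceil_div_bounds ((r.+1 * (n + j) + i)%N%:Z + 1 - (lam j')%:Z) _ r_gt0.
set c := ceil_div _ _ => /andP[c1 c2].
have r0 : 0 < r%:R :> R by rewrite ltr0n.
have -> : b j' + c%:~R - r.+1%:R / r%:R * n.+1%:R
    = b j' + (c * r%:Z - r.+1%:Z * n.+1%:Z)%:~R / r%:R.
  by rewrite intrB !intrM -!pmulrn; field; rewrite gt_eqF.
apply: le_trans (ler_normD _ _) _.
rewrite lerD2l normrM [`|_^-1|]gtr0_norm ?invr_gt0 //.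
rewrite ler_pdivrMr // -[r%:R]/(r%:Z%:~R) -intrD -intrM -intr_norm ler_int.
by nia.
Qed.

(* The leading term of [alpha_(r+1)(n+j)+l] as [n] tends to infinity. *)
Definition alpha_lead (n j l : nat) : R :=
  (r%:R / r.+1%:R) ^+ s
  * r.+1%:R ^- (residue1 (n + j + l)%N%:Z r \in lams s lam) * n%:R ^+ (r - s).

Lemma alpha_lead_gt0 n j l : 0 < alpha_lead n.+1 j l.
Proof.
rewrite /alpha_lead !mulr_gt0 ?exprn_gt0 ?invr_gt0 ?exprn_gt0 //.
by rewrite divr_gt0 ?ltr0n.
Qed.

(** The numerator has r factors of order n, the denominator s factors of order n(r+1)/r. *)
Lemma base_cvg (i j : nat) : (1 <= i <= r.+1)%N ->
  (fun n => (\prod_(1 <= i' < r.+2 | i' != i) Ash (r.+1 * (n + j) + i)%N%:Z i')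
      / (\prod_(1 <= j' < s.+1) Bsh (r.+1 * (n + j) + i)%N%:Z j')
      / n.+1%:R ^+ (r - s)) @ \oo --> ((r%:R / r.+1%:R) ^+ s : R).
Proof.
move=> ir.
have scale n : \prod_(1 <= i' < r.+2 | i' != i) n.+1%:R = n.+1%:R ^+ r :> R.
  apply: (@mulfI _ n.+1%:R); rewrite ?pnatr_eq0 // -exprS.
  transitivity (\prod_(1 <= i' < r.+2) n.+1%:R : R).
    by rewrite [RHS](bigD1_seq i) ?iota_uniq ?mem_index_iota.
  by rewrite prodr_const_nat subn1.
have -> : (r%:R / r.+1%:R) ^+ s = (\prod_(1 <= i' < r.+2 | i' != i) 1)
    / (\prod_(1 <= j' < s.+1) (r.+1%:R / r%:R)) :> R.
  by rewrite big1_eq div1r prodr_const_nat subn1 /= -exprVn invf_div.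
have A1 := cvg_prod_seq _ _ (index_iota 1 r.+2) (fun i' => i' != i) _ (fun=> 1)
  (fun i' _ => ashift_cvg i j i').
have B1 := cvg_prod_seq _ _ (index_iota 1 s.+1) xpredT _ (fun=> r.+1%:R / r%:R)
  (fun j' _ => bshift_cvg i j j').
have B0 : \prod_(1 <= j' < s.+1) (r.+1%:R / r%:R) != 0 :> R.
  rewrite prodr_const_nat expf_neq0 // mulf_neq0 ?invr_eq0 ?pnatr_eq0 //.
  by rewrite -lt0n.
apply: cvg_eq (cvgM A1 (cvgV B0 B1)) => n /=.
rewrite !big_split /= !prodfV scale prodr_const_nat subn1 /=.
have -> : n.+1%:R ^+ r = n.+1%:R ^+ s * n.+1%:R ^+ (r - s) :> R.
  by rewrite -exprD subnKC.
have n0 : n.+1%:R != 0 :> R by rewrite pnatr_eq0.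
have C0 : \prod_(1 <= j' < s.+1) Bsh (r.+1 * (n + j) + i)%N j' != 0.
  rewrite gt_eqF // big_seq prodr_gt0 // => j'; rewrite mem_index_iota => js.
  exact: bshift_gt0.
by field; rewrite C0 !expf_neq0.
Qed.

(** The numerator grows like n/r and the denominator like n(r+1)/r; this is the source of the powers
    of 1/(r+1) in the constants. *)
Lemma factor_cvg (i j l : nat) : (1 <= l <= s)%N ->
  (fun n => let k := (r.+1 * (n + j) + i)%N%:Z in
     r.+1%:R * ((Bsh k l - Ash k i) / (Bsh k l - 1)) : R) @ \oo --> (1 : R).
Proof.
move=> ls /=; have r0 : r%:R != 0 :> R by rewrite pnatr_eq0 -lt0n.
have r1 : r.+1%:R != 0 :> R by rewrite pnatr_eq0.
(* The subtracted 0 is the limit of 1/(n+1), coming from the -1 in the denominator. *)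
have one : (1 : R) = r.+1%:R * ((r.+1%:R / r%:R - 1) / (r.+1%:R / r%:R - 0)).
  by rewrite -natr1 in r1 *; field; rewrite r0 r1.
rewrite [X in _ --> X]one.
have D1 := cvgB (bshift_cvg i j l) (ashift_cvg i j i).
have D2 := cvgB (bshift_cvg i j l) (@cvg_harmonic R).
have D0 : r.+1%:R / r%:R - 0 != 0 :> R by rewrite subr0 mulf_neq0 ?invr_eq0.
apply: cvg_eq (cvgMl_tmp (cvgM (D1 _) (cvgV D0 (D2 _)))) => n /=.
rewrite !fctE /harmonic -mulrBl -[X in _ / (_ / _ - X)]mul1r -mulrBl -mulf_div.
by rewrite divff ?mulr1 // invr_eq0 pnatr_eq0.
Qed.

Lemma alpha_cvg (j l : nat) : (l <= r)%N ->
  (fun n => alph (r.+1 * (n.+1 + j) + l) / alpha_lead n.+1 j l) @ \oo --> (1 : R).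
Proof.
(* Subtracting r from the index of alpha leaves (r+1)(n+j) + l + 1, whose residue modulo r+1 is l +
   1. *)
move=> lr; set i := l.+1.
have ir : (1 <= i <= r.+1)%N by [].
pose K n := (r.+1 * (n + j) + i)%N.
pose base n := \prod_(1 <= i' < r.+2 | i' != i) Ash (K n)%:Z i'
      / \prod_(1 <= j' < s.+1) Bsh (K n)%:Z j'.
pose c n := residue1 (K n)%:Z r.
pose w n : R := if c n \in lams s lam then
  let l := (index (c n) (lams s lam)).+1 in
  r.+1%:R * ((Bsh (K n)%:Z l - Ash (K n)%:Z i) / (Bsh (K n)%:Z l - 1)) else 1.
have w_cvg : w @ \oo --> (1 : R).
  (* Which lambda is met, if any, varies with n, so the distance of [w] from 1 is bounded by the sum
     over all of them. *)
  pose v n : R := \sum_(1 <= l < s.+1)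
    `|r.+1%:R * ((Bsh (K n)%:Z l - Ash (K n)%:Z i) / (Bsh (K n)%:Z l - 1)) - 1|.
  have v0 : v @ \oo --> (0 : R).
    have -> : 0 = \sum_(1 <= l < s.+1) `|1 - 1| :> R.
      by rewrite big1 // subrr normr0.
    rewrite /v; under eq_fun do rewrite big_nat.
    rewrite big_nat; apply: cvg_big => [|l' ls]; first exact: add_continuous.
    by apply: cvg_norm; apply: cvgB; [exact: factor_cvg|exact: cvg_cst].
  apply/cvgrPdist_le => e e0; near=> n; rewrite distrC.
  have vn : v n <= e.
    near: n; move/cvgrPdist_le: v0 => /(_ e e0); apply: filterS => n.
    by rewrite sub0r normrN; apply: le_trans; exact: ler_norm.
  apply: le_trans vn; rewrite /w; case: ifP => [/lams_index[ls _]|_].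
    rewrite /v (bigD1_seq (index (c n) (lams s lam)).+1) ?iota_uniq //=.
      by rewrite lerDl sumr_ge0.
    by rewrite mem_index_iota.
  by rewrite subrr normr0 sumr_ge0.
have one : (1 : R) = (r%:R / r.+1%:R) ^+ s / (r%:R / r.+1%:R) ^+ s * 1.
  by rewrite mulr1 divff // expf_neq0 // mulf_neq0 ?invr_eq0 ?pnatr_eq0 // -lt0n.
rewrite [X in _ --> X]one.
apply: cvg_eq (cvgM (cvgMr_tmp (base_cvg i j ir)) w_cvg) => n /=.
have -> : (r.+1 * (n.+1 + j) + l = K n + r)%N by rewrite /K /i; nia.
rewrite alphaD /alpha_from -/Ash -/Bsh.
have -> : residue1 (K n)%:Z r.+1 = i.
  rewrite /K addnC PoszD PoszM residue1_mul; apply/esym/eqP.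
  by rewrite residue1E // subrr dvdz0.
rewrite -/(base n) -/(c n) /alpha_lead.
have -> : residue1 (n.+1 + j + l)%N%:Z r = c n.
  rewrite /c -(residue1_mul (n.+1 + j + l)%N%:Z (n + j)%:Z).
  by congr residue1; rewrite /K /i; lia.
have -> : (K n == 0%N) = false by rewrite /K /i addnS.
have n0 : n.+1%:R ^+ (r - s) != 0 :> R by rewrite expf_neq0 ?pnatr_eq0.
have r1 : r.+1%:R != 0 :> R by rewrite pnatr_eq0.
have q0 : (r%:R / r.+1%:R) ^+ s != 0 :> R.
  by rewrite expf_neq0 // mulf_neq0 ?invr_eq0 ?pnatr_eq0 // -lt0n.
rewrite /w -/(base n); set X := base n; set q := _ ^+ s in q0 *.
set N := _ ^+ (r - s) in n0 *.
case: ifPn => [/negPf ->|/negPn ->] /=.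
  by rewrite expr0 invr1 !mulr1 invfM mulrA mulrAC.
rewrite expr1; move: (_ / (_ - 1)) => Y; rewrite -natr1 in r1 *.
by field; rewrite n0 q0 r1.
Unshelve. all: by end_near. Qed.

(** The exponents of r+1 add up to [lam_count], and replacing n+1 by its residue modulo r changes
    none of the residues counted. *)
Lemma gamma_const_lead n k : gamma_const R r s lam k (residue1 n.+1%:Z r)
    * n.+1%:R ^+ ((r - s) * k.+1) =
  \sum_(l : {ffun 'I_k.+1 -> 'I_r.+1} | decreasing l)
    \prod_(j < k.+1) alpha_lead n.+1 j (l j).
Proof.
rewrite /gamma_const mulrAC mulr_sumr; apply: eq_bigr => l _.
rewrite /alpha_lead !big_split /= !prodr_const card_ord -!exprM mulrAC.
congr (_ * _ * _); rewrite prodfV prodrXr /lam_count -sum1_card big_mkcond /=.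
congr (_ ^- _); apply: eq_bigr => j _; rewrite inE.
have -> : residue1 (residue1 n.+1%:Z r + l j + j)%N%:Z r =
    residue1 (n.+1 + j + l j)%N%:Z r.
  apply/esym/residue1_unique; first exact: residue1_bounds.
  rewrite residue1_mod // !PoszD -[in RHS]addrA -[in RHS]modzDml
    residue1_mod // modzDml.
  by congr (_ %% _)%Z; ring.
by case: (_ \in lams s lam).
Qed.

(** The leading products are positive, so errors relative to each of finitely many terms add up to
    an error relative to their sum. *)
Lemma gamma_equiv k :
  (fun n : nat => gamma r s lam a b k n : R^o) ~_\oo
  (fun n : nat => gamma_const R r s lam k (residue1 n%:Z r)
                  * n%:R ^+ ((r - s) * k.+1) : R^o).
Proof.
pose u n (l : {ffun 'I_k.+1 -> 'I_r.+1}) : R := \prod_(j < k.+1)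
  (alph (r.+1 * (n.+1 + j) + l j) / alpha_lead n.+1 j (l j)).
pose v n : R := \sum_(l : {ffun 'I_k.+1 -> 'I_r.+1}) `|u n l - 1|.
have v0 : v @ \oo --> (0 : R).
  have -> : 0 = \sum_(l : {ffun 'I_k.+1 -> 'I_r.+1}) `|1 - 1| :> R.
    by rewrite big1 // subrr normr0.
  apply: cvg_big => [|l _]; first exact: add_continuous.
  apply: cvg_norm; apply: cvgB; last exact: cvg_cst.
  have -> : (1 : R) = \prod_(j < k.+1) 1 by rewrite big1.
  by apply: cvg_prod_seq => j _; apply: alpha_cvg; rewrite -ltnS.
apply/eqaddoP => e e0.
have [N _ vN] := cvgr0_norm_le _ v0 _ e0.
exists N.+1 => // -[//|n] /= Nn.
rewrite !fctE. rewrite gamma_const_lead /gamma -sumrB.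
have lead0 (l : {ffun 'I_k.+1 -> 'I_r.+1}) :
    0 < \prod_(j < k.+1) alpha_lead n.+1 j (l j).
  by rewrite prodr_gt0 // => j _; exact: alpha_lead_gt0.
rewrite [X in _ <= _ * X]ger0_norm ?sumr_ge0 // => [|l _]; last exact: ltW.
apply: le_trans (ler_norm_sum _ _ _) _; rewrite mulr_sumr.
apply: ler_sum => l _; have -> : \prod_(j < k.+1) alph (r.+1 * (n.+1 + j) + l j)
    = u n l * \prod_(j < k.+1) alpha_lead n.+1 j (l j).
  by rewrite -big_split /=; apply: eq_bigr => j _;
    rewrite divfK // gt_eqF ?alpha_lead_gt0.
rewrite -[X in _ - X]mul1r -mulrBl normrM (gtr0_norm (lead0 l)) ler_pM2r //.
apply: le_trans (vN n Nn); rewrite [leRHS]ger0_norm ?sumr_ge0 //.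
by rewrite /v (bigD1 l) //= lerDl sumr_ge0.
Qed.

(** * The recurrence for the hypergeometric polynomials *)

Lemma hyp_poly_rec n x : hyp_poly r s lam a b n.+1 x =
  x * hyp_poly r s lam a b n x
  - \sum_(0 <= k < r.+1 | (k <= n)%N)
      gamma r s lam a b k (n - k) * hyp_poly r s lam a b (n - k) x.
Proof.
pose F n l := alph (r.+1 * n + l).
have gammaE k m : gamma r s lam a b k m = decr_sum R r F r.+1 k.+1 m.
  (* The bound [r.+1] on the entries is automatic for values in ['I_r.+1]. *)
  apply: eq_bigl => l; rewrite /decr_below [X in _ && X](_ : _ = true) ?andbT //.
  exact/forallP.
rewrite !hyp_polyE (@decr_sum_rec R r F x (fun m j => comp_poly m j x)).
- by congr (_ - _); apply: eq_bigr => k _; rewrite gammaE hyp_polyE.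
- by move=> j jr; rewrite /F muln0 alpha_lt.
- by move=> j _; rewrite !comp_poly0.
- by move=> m j jr; rewrite comp_polyS.
- by move=> m; rewrite comp_poly_top.
Qed.

End Recurrence.

Theorem proposition8p2 (R : realType) (r s : nat) (lam : nat -> nat)
    (a b : nat -> R)
    (s_le_r : (s <= r)%N) (r_neq0 : r <> 0%N)
    (lam_bounds : forall j : nat, (1 <= j <= s)%N -> (1 <= lam j <= r)%N)
    (lam_incr : forall i j : nat, (1 <= i)%N -> (i < j)%N -> (j <= s)%N ->
       (lam i < lam j)%N)
    (a_pos : forall i : nat, (1 <= i <= r)%N -> 0 < a i)
    (b_pos : forall j : nat, (1 <= j <= s)%N -> 0 < b j)
    (a_lt_b : forall i j : nat, (1 <= i <= r)%N -> (1 <= j <= s)%N ->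
       ((i <= lam j)%N -> a i < b j) /\
       ((lam j + 1 <= i)%N -> a i - 1 < b j)) :
  [/\ forall (n : nat) (x : R),
        hyp_poly r s lam a b n.+1 x =
        x * hyp_poly r s lam a b n x
        - \sum_(0 <= k < r.+1 | (k <= n)%N)
            gamma r s lam a b k (n - k) * hyp_poly r s lam a b (n - k) x,
      forall k n : nat, (k <= r)%N -> 0 < gamma r s lam a b k n &
      forall k : nat, (k <= r)%N ->
        (fun n : nat => gamma r s lam a b k n : R^o) ~_\oo
        (fun n : nat => gamma_const R r s lam k (residue1 n%:Z r)
                        * n%:R ^+ ((r - s) * k.+1) : R^o)].
Proof.
have r_gt0 : (0 < r)%N by rewrite lt0n; apply/eqP.
split; [exact: hyp_poly_rec | exact: gamma_gt0 | by move=> k _; exact: gamma_equiv].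
Qed.
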